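(* Let $Y$ be a metric space containing at least two points, $X$ a $Y$-Tychonoff space, and let $H$ be a subspace of $B(X,Y)$ containing $B_1^{st}(X,Y)$. Then the following assertions are equivalent: (i) $H$ is metrizable and $H=Y^X$; (ii) $H$ is a $\sigma$-space; (iii) $H$ has countable $cs^\ast$-character; (iv) $X$ is countable.
   Context: $X$ is $Y$-Tychonoff if for every closed $A\subseteq X$, point $y_0\in Y$ and function $f:F\to Y$ on a finite set $F\subseteq X\setminus A$ there is a continuous $\bar f:X\to Y$ with $\bar f|_F=f$ and $\bar f(A)\subseteq\{y_0\}$. $B_0(X,Y)=C(X,Y)$ is the set of continuous functions; for a nonzero countable ordinal $\alpha$, $B_\alpha(X,Y)$ is the set of functions $X\to Y$ that are pointwise limits of sequences from $\bigcup_{\beta<\alpha}B_\beta(X,Y)$; $B(X,Y)=\bigcup_{\alpha<\omega_1}B_\alpha(X,Y)$. $B_1^{st}(X,Y)$ is the set of all $f:X\to Y$ for which there is a sequence $\{f_n\}$ in $C(X,Y)$ stably converging to $f$, i.e. for every $x\in X$ the set $\{n: f_n(x)\ne f(x)\}$ is finite. All these sets carry the topology of pointwise convergence inherited from the product $Y^X$. A family $\mathcal N$ of subsets of a space $Z$ is a network if for each $z\in Z$ and each neighborhood $O$ of $z$ there is $N\in\mathcal N$ with $z\in N\subseteq O$. $Z$ is a $\sigma$-space if it has a $\sigma$-locally finite network (a network that is a countable union of locally finite families). A family $\mathcal N$ is a $cs^\ast$-network at $z\in Z$ if for each sequence $(z_n)$ converging to $z$ and each neighborhood $O$ of $z$ there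 is $N\in\mathcal N$ with $z\in N\subseteq O$ and $\{n: z_n\in N\}$ infinite. $Z$ has countable $cs^\ast$-character if it has a countable $cs^\ast$-network at each point. *)

(* Defs.v *)
From mathcomp Require Import all_boot all_order all_algebra.
From mathcomp Require Import wochoice.
From mathcomp Require Import all_classical all_reals all_analysis.

Set Implicit Arguments.
Unset Strict Implicit.
Unset Printing Implicit Defensive.

Import Order.TTheory GRing.Theory Num.Theory.

Local Open Scope classical_set_scope.
Local Open Scope ring_scope.

(* A function on the finite set F is given as (the restriction to F of) a
   function on X: since y0 : Y is at hand, every function F -> Y extends to X. *)
Definition Y_Tychonoff (X Y : topologicalType) : Prop :=
  forall (A : set X) (y0 : Y) (F : set X) (f : X -> Y),
    closed A -> finite_set F -> F `<=` ~` A ->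
    exists g : X -> Y,
      [/\ continuous g, forall x, F x -> g x = f x & g @` A `<=` [set y0]].

(* Countable ordinals are represented by the elements of countable well-ordered
   sets (W, le): an element a stands for the order type of its set of strict
   predecessors, and every countable ordinal arises in this way.  The least
   element stands for the ordinal 0.  In the second constructor, b n is an
   ordinal below a to whose class the n-th term of the sequence belongs;
   cf. [Baire_class0E] and [Baire_class_limE] below. *)
Inductive Baire_class (X Y : topologicalType) (W : countType) (le : rel W) :
    W -> (X -> Y) -> Prop :=
| Baire_class0 (a : W) (f : X -> Y) :
    (forall b, le a b) -> continuous f -> Baire_class le a f
| Baire_class_lim (a : W) (b : nat -> W) (u : nat -> X -> Y) (f : X -> Y) :
    (forall n, le (b n) a && (b n != a)) ->
    (forall n, Baire_class le (b n) (u n)) ->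
    (forall x, (fun n => u n x) @ \oo --> f x) ->
    Baire_class le a f.

Section Baire_class_equations.
Variables (X Y : topologicalType) (W : countType) (le : rel W).
Hypothesis wo_le : well_order le.

Let le_anti (x y : W) : le x y -> le y x -> x = y.
Proof.
move=> xy yx; apply: (@wo_chain_antisymmetric W le predT) => //.
- by move=> A _; exact: wo_le.
- by rewrite xy yx.
Qed.

Lemma Baire_class0E (a : W) : (forall b, le a b) ->
  Baire_class le a = [set f : X -> Y | continuous f].
Proof.
move=> a0; apply/seteqP; split => f /=; last exact: Baire_class0.
move=> Bf; case: Bf a0 => // a' b u f' ba _ _ a0.
have /andP[b0a /eqP[]] := ba 0%N.
exact: le_anti.
Qed.

Lemma Baire_class_limE (a : W) : (exists b, ~~ le a b) ->
  Baire_class le a = [set f : X -> Y | exists u : nat -> X -> Y,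
    (forall n, exists2 b, le b a && (b != a) & Baire_class le b (u n)) /\
    (forall x, (fun n => u n x) @ \oo --> f x)].
Proof.
move=> [c nac]; apply/seteqP; split => f /=.
  move=> Bf; case: Bf c nac => [a' f' a0 _ c|a' b u f' ba bu uf _ _].
    by rewrite a0.
  by exists u; split => // n; exists (b n).
move=> [u [ub uf]].
have /choice[b bP] : forall n, exists b,
    (le b a && (b != a)) /\ Baire_class le b (u n).
  by move=> n; have [b] := ub n; exists b.
by apply: (@Baire_class_lim _ _ _ _ a b u) => // n; have [] := bP n.
Qed.

End Baire_class_equations.

(* The union of the classes over all countable ordinals. *)
Definition Baire_functions (X Y : topologicalType) : set (X -> Y) :=
  [set f | exists (W : countType) (le : rel W) (a : W),
    well_order le /\ Baire_class le a f].

Definition stable_Baire1 (X Y : topologicalType) : set (X -> Y) :=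
  [set f | exists u : nat -> X -> Y,
    (forall n, continuous (u n)) /\
    (forall x, finite_set [set n | u n x <> f x])].

Definition metrizable (R : realType) (T : topologicalType) : Prop :=
  exists d : T -> T -> R,
    [/\ forall x y, (d x y = 0) <-> (x = y),
        forall x y, d x y = d y x,
        forall x y z, d x z <= d x y + d y z &
        forall (x : T) (A : set T), nbhs x A <->
          exists2 e : R, 0 < e & [set y | d x y < e] `<=` A].

Definition network (T : topologicalType) (N : set (set T)) : Prop :=
  forall (z : T) (O : set T), nbhs z O ->
    exists A : set T, [/\ N A, A z & A `<=` O].

Definition locally_finite (T : topologicalType) (N : set (set T)) : Prop :=
  forall z : T, exists2 U : set T, nbhs z U &
    finite_set [set A | N A /\ A `&` U !=set0].

Definition sigma_space (T : topologicalType) : Prop :=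
  exists N : nat -> set (set T),
    (forall n, locally_finite (N n)) /\ network (\bigcup_n N n).

Definition cs_star_network_at (T : topologicalType) (z : T)
    (N : set (set T)) : Prop :=
  forall (u : nat -> T) (O : set T), u @ \oo --> z -> nbhs z O ->
    exists A : set T, [/\ N A, A z, A `<=` O & infinite_set [set n | A (u n)]].

Definition countable_cs_star_character (T : topologicalType) : Prop :=
  forall z : T, exists2 N : set (set T), countable N & cs_star_network_at z N.

(* Main.v *)
Require Import Defs.
From mathcomp Require Import all_boot all_order all_algebra.
From mathcomp Require Import wochoice.
From mathcomp Require Import all_classical all_reals all_analysis.
From mathcomp Require Import lra.

(** If [X] is countable, prescribing values at more and more points shows that
    every function [X -> Y] is a stable limit of continuous ones, so that [H] is
    the whole countable power of [Y], hence metrizable; metrizable spaces are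
    sigma-spaces and have countable cs*-character.  The substance lies in
    deducing the countability of [X] from either of the two network conditions
    on [H], and it rests on one construction, [stable_indicator]: for a point
    [x] and countably many continuous [phi i : X -> Y] there is a stable limit
    [f] of continuous functions that only takes the values [y0] and [y1], with
    [f x = y1], and with [f z = y1] only where every [phi i] agrees with its
    value at [x].

    Sigma-spaces.  In a Hausdorff sigma-space every point is the intersection of
    countably many of its neighbourhoods.  At the constant function [y0] of [H]
    these neighbourhoods restrict values on a countable set [S] of points only.
    If [x] were outside [S], a stable indicator of [x] built from maps that
    separate [x] from each point of [S] would lie in all of them without being
    constant.

    Countable cs*-character.  Enumerate a countable cs*-network at the constant
    function [y0], and let [O x] be the neighbourhood of the functions not equal
    to [y1] at [x].  The type of [x] at level [m] records which of the first [m]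
    members of the network are contained in [O x].  There are countably many
    types, so if [X] is uncountable, some [x] shares each of its types with
    infinitely many points.  Choose distinct points [p m] such that [p m] lies
    in the class of the [m]-th type of [x], and stable indicators [f m] of the
    points [p m] whose supports are pairwise disjoint.  Then [f m] tends to the
    constant [y0], so some member of the network inside [O x] contains [f m] for
    infinitely many [m].  For large [m] that member is also contained in
    [O (p m)], although [f m (p m) = y1]. *)

Set Implicit Arguments.
Unset Strict Implicit.
Unset Printing Implicit Defensive.

Import Order.TTheory GRing.Theory Num.Theory.
Import metricType_numDomainType.

Local Open Scope classical_set_scope.
Local Open Scope ring_scope.

(** * Auxiliary facts on numbers and infinite sets *)

Lemma ex_natSinv_lt {R : realType} (e : R) :
  0 < e -> exists n, n.+1%:R^-1 < e.
Proof.
move=> e0; have [n _ /(_ n (leqnn n))] := near_infty_natSinv_lt (PosNum e0).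
by exists n.
Qed.

Lemma min_triangle {R : realType} (a b c w : R) :
  0 <= a -> 0 <= b -> 0 <= w -> c <= a + b ->
  Num.min c w <= Num.min a w + Num.min b w.
Proof.
move=> a0 b0 w0 cab; rewrite !minEle.
by case: (leP c w) => cw; case: (leP a w) => aw; case: (leP b w) => bw; lra.
Qed.

Lemma infinite_geq (m : nat) : infinite_set [set k | (m <= k)%N].
Proof.
apply: sub_infinite_set (infinite_setD infinite_nat (finite_II m)).
by move=> k [_ /negP]; rewrite /= -leqNgt.
Qed.

Lemma infinite_sets_transversal (T : eqType) (E : nat -> set T) :
  (forall m, infinite_set (E m)) ->
  exists x : nat -> T, injective x /\ forall m, E m (x m).
Proof.
move=> infE.
have /choice[next nextP] : forall p : seq T * nat,
    exists x, E p.2 x /\ x \notin p.1.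
  move=> [s m].
  have /infinite_setN0[x [Ex sx]] := infinite_setD (infE m) (finite_seq s).
  by exists x; split=> //; apply/negP.
(* [L m] lists the points already chosen, which the [m]-th one must avoid. *)
pose L := fix L n : seq T := if n is m.+1 then next (L m, m) :: L m else [::].
have subL m n : (m <= n)%N -> {subset L m <= L n}.
  move=> /subnK <-; elim: (n - m)%N => [//|k IHk] x /IHk xL.
  by rewrite addSn inE xL orbT.
exists (fun m => next (L m, m)); split=> [m n|m]; last first.
  by have [] := nextP (L m, m).
wlog mn : m n / (m <= n)%N => [wlg eq_mn|].
  have [/wlg|/ltnW/wlg] := leqP m n; first exact.
  by move=> nm; apply/esym/nm.
move: mn; rewrite leq_eqVlt => /predU1P[//|mn] eq_mn.
have [_ /negP[]] := nextP (L n, n); rewrite -eq_mn /=.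
by apply: (subL _ _ mn); exact: mem_head.
Qed.

(** * Metrizable spaces and sigma-spaces *)

Section Metrizable.
Context {R : realType} {T : topologicalType}.

(** The balls of radius [1 / (n + 1)] form a countable base at each point. *)
Lemma metrizable_cs_star : metrizable R T -> countable_cs_star_character T.
Proof.
move=> [d [d0 dC dT dN]] z; pose B n := [set y | d z y < n.+1%:R^-1].
have nB n : nbhs z (B n) by apply/dN; exists n.+1%:R^-1 => //; rewrite invr_gt0.
exists (range B); first exact: sub_countable (card_image_le _ _) _.
move=> u O uz /dN[e e0 eO].
have [n ne] := ex_natSinv_lt e0.
exists (B n); split.
- by exists n.
- exact: nbhs_singleton.
- by move=> y /= By; apply: eO => /=; apply: lt_trans ne.
- have [m _ mB] : \forall m \near \oo, B n (u m) by exact: uz.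
  apply: (@sub_infinite_set _ [set k | (m <= k)%N]).
    by move=> k; exact: mB.
  exact: infinite_geq.
Qed.

(** This is the disjointification step of Stone's theorem on refinements of
    open covers.  Well-order the points, and cut the ball of radius
    [r = 1 / (n + 1)] around [s] down to the points that are within
    [r - 1 / (k + 1)] of [s] and at distance at least [r] from every earlier
    centre.  For fixed [n] and [k], cells with different centres are at
    distance at least [1 / (k + 1)], so the family is discrete; and each point
    lies in the cell of the first centre within [r] of it, for [k] large.  A
    network need not consist of open sets, so no thickening is necessary. *)
Lemma metrizable_sigma_space : metrizable R T -> sigma_space T.
Proof.
move=> [d [d0 dC dT dN]].
have [le wo_le] := well_ordering_principle T.
have le_tot s t : s != t -> (le s t /\ s != t) \/ (le t s /\ t != s).
  move=> st; rewrite (eq_sym t) st.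
  have /orP[] : le s t || le t s; last by right.
    by apply: (@wo_chainW T le predT); move=> // A _; exact: wo_le.
  by left.
pose C (n k : nat) (s : T) : set T :=
  [set x | d s x < n.+1%:R^-1 - k.+1%:R^-1 /\
    forall t, le t s -> t != s -> n.+1%:R^-1 <= d t x].
pose N p := if unpickle p is Some (n, k) then range (C n k) else set0.
exists N; split => [p z|z O /dN[e e0 eO]].
- rewrite /N; case: unpickle => [[n k]|]; last first.
    exists setT; first exact: filterT.
    by apply: sub_finite_set (@finite_set0 _) => A [].
  pose r : R := k.+1%:R^-1.
  have r0 : 0 < r by rewrite invr_gt0.
  exists [set y | d z y < r / 2].
    by apply/dN; exists (r / 2) => //; rewrite divr_gt0.
  have sep s t x y : le t s -> t != s -> C n k s x -> C n k t y ->
      d z x < r / 2 -> d z y < r / 2 -> False.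
    move=> ts ts' [_ /(_ _ ts ts') sx] [ty _] zx zy.
    have := dT t y x; have := dT y z x; rewrite (dC y z); rewrite -/r in ty.
    clearbody r; move: (n.+1%:R^-1) sx ty => q sx ty; lra.
  pose D := [set A | range (C n k) A /\ A `&` [set y | d z y < r / 2] !=set0].
  rewrite -/D; have [->|/set0P[A0 DA0]] := eqVneq D set0.
    exact: finite_set0.
  apply: (@sub_finite_set _ _ [set A0]) => // A [[s _ <-] [x [Cx zx]]].
  case: DA0 => [[t _ <-] [y [Cy zy]]] /=.
  have [->//|/le_tot[[st ns]|[ts nt]]] := eqVneq s t.
    by case: (sep _ _ _ _ st ns Cy Cx zy zx).
  by case: (sep _ _ _ _ ts nt Cx Cy zx zy).
- (* A cell has diameter at most twice the radius, hence the bound [e / 2]. *)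
  have [n ne] : exists n, n.+1%:R^-1 < e / 2.
    by apply: ex_natSinv_lt; rewrite divr_gt0.
  pose P := [pred s | d s z < n.+1%:R^-1].
  have [|s [[Ps minS] _]] := wo_le P.
    by exists z; rewrite inE /= (d0 z z).2.
  have [k ke] : exists k, k.+1%:R^-1 < n.+1%:R^-1 - d s z.
    by apply: ex_natSinv_lt; rewrite subr_gt0.
  exists (C n k s); split.
  + exists (pickle (n, k)) => //; rewrite /N pickleK; by exists s.
  + split; first by rewrite ltrBrDl -ltrBrDr.
    move=> t ts tns; rewrite leNgt; apply/negP => tz.
    case/negP: tns; apply/eqP.
    apply: (@wo_chain_antisymmetric T le predT (fun A _ => wo_le A)) => //.
    by rewrite ts minS.
  + move=> x [sx _]; apply: eO => /=.
    have := dT z s x; rewrite (dC z s).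
    rewrite inE /= in Ps.
    have k0 : 0 < k.+1%:R^-1 :> R by rewrite invr_gt0.
    move: (n.+1%:R^-1) (k.+1%:R^-1) ne Ps k0 sx => q r; lra.
Qed.

End Metrizable.

(** Given a level of the network, discard the members whose closure contains
    [z]; by local finiteness the others stay away from a neighbourhood of [z].
    In a Hausdorff space each point [y] different from [z] belongs to one of
    those other members, namely to any one inside a neighbourhood of [y] that is
    disjoint from a neighbourhood of [z]. *)
Lemma sigma_space_point_Gdelta (T : topologicalType) (z : T) :
  hausdorff_space T -> sigma_space T ->
  exists G : nat -> set T, (forall n, nbhs z (G n)) /\
    forall y, (forall n, G n y) -> y = z.
Proof.
move=> hausT [N [lfN netN]].
exists (fun n => ~` \bigcup_(A in [set A | N n A /\ ~ closure A z]) A).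
split=> [n|y Gy].
- have [U zU finU] := lfN n z.
  pose F := [set A | N n A /\ A `&` U !=set0] `&` [set A | ~ closure A z].
  have oF : open (~` \bigcup_(A in F) closure A).
    apply: closed_openC; apply: closed_bigcup.
      by apply: sub_finite_set finU => A [].
    by move=> A _; exact: closed_closure.
  have zF : nbhs z (~` \bigcup_(A in F) closure A).
    by apply: open_nbhs_nbhs; split=> // -[A [_ nAz] /nAz].
  apply: filterS (filterI zU zF) => y [Uy nFy] [A [NA nAz] Ay].
  apply: nFy; exists A; last exact: subset_closure.
  by split=> //; split=> //; exists y.
- apply: contrapT => yz.
  move: hausT; rewrite open_hausdorff => /(_ y z).
  case=> [|[U V] /= [yU zV] [oU oV UV]]; first exact/eqP.
  have [A [[n _ NA] Ay AU]] :
      exists A, [/\ (\bigcup_n N n) A, A y & A `<=` U].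
    by apply: netN; apply: open_nbhs_nbhs; split=> //; exact: set_mem.
  apply: (Gy n); exists A => //; split=> // /(_ V).
  case=> [|w [Aw Vw]].
    by apply: open_nbhs_nbhs; split=> //; exact: set_mem.
  by move/eqP/disjoints_subset : UV => /(_ w (AU _ Aw)).
Qed.

(** * Subspaces of the space of all functions *)

Section PointwiseNbhs.
Context {R : realType} {X : topologicalType} {Y : metricType R}.

Lemma nbhs_ptwsP (f : {ptws X -> Y}) (A : set {ptws X -> Y}) :
  nbhs f A <-> exists (s : seq X) (e : R), 0 < e /\
    forall g : X -> Y, {in s, forall x, mdist (f x) (g x) < e} -> A g.
Proof.
pose B (p : seq X * R) : set {ptws X -> Y} :=
  [set g | {in p.1, forall x, mdist (f x) (g x) < p.2}].
pose F := filter_from [set p : seq X * R | 0 < p.2] B.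
have FF : Filter F.
  apply: filter_from_filter; first by exists ([::], 1) => /=.
  move=> [s d] [t e] /= d0 e0; exists (s ++ t, Num.min d e) => /=.
    by rewrite lt_min d0.
  move=> g Bg; split=> x xs; have := Bg x; rewrite mem_cat xs ?orbT => /(_ isT);
    by rewrite lt_min => /andP[].
split; last first.
  move=> [s [e [e0 sA]]]; apply: (filterS (P := B (s, e))).
    by move=> g; exact: sA.
  elim: s {sA} => [|x s IHs]; first by apply: filterE => g y.
  have fx : nbhs f [set g : {ptws X -> Y} | mdist (f x) (g x) < e].
    have /(_ f) := @proj_continuous X (fun=> Y) x.
    move=> /(_ [set y | mdist (f x) y < e]); apply.
    by rewrite -filter_from_mdist_nbhs; exists e.
  apply: filterS (filterI fx IHs) => g [/= gx gs] y.
  by rewrite inE => /predU1P[->|/gs].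
(* The product topology is a supremum, so [F] converges to [f] as soon as each
   of its coordinates does: no finite intersections have to be unfolded. *)
suff FA : F --> f by move=> /FA[[s e] /= e0 sA]; exists s, e; split.
apply/cvg_sup => x; apply/cvg_image.
  by apply/seteqP; split=> // y _; exists (fun=> y).
move=> V; rewrite -filter_from_mdist_nbhs => -[e /= e0 eV].
exists [set g : X -> Y | V (g x)].
  exists ([:: x], e) => // g /= /(_ x); rewrite mem_head => /(_ isT) gx.
  exact: eV.
apply/seteqP; split=> [y [g Vg <-]//|y Vy]; by exists (fun=> y).
Qed.

Variable H : set {ptws X -> Y}.

Lemma nbhs_subspaceP (z : set_type H) (A : set (set_type H)) :
  nbhs z A <-> exists (s : seq X) (e : R), 0 < e /\
    forall h : set_type H, {in s, forall x, mdist (val z x) (val h x) < e} ->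
      A h.
Proof.
split.
- move=> [_ [[B oB <-] /= Bz BA]].
  have /nbhs_ptwsP [s [e [e0 sB]]] : nbhs (val z) B by exact: open_nbhs_nbhs.
  by exists s, e; split => // h zh; apply: BA => /=; exact: sB.
- move=> [s [e [e0 sA]]].
  have cval : continuous (set_val : set_type H -> {ptws X -> Y}).
    exact: (@initial_continuous (set_type H) {ptws X -> Y} set_val).
  pose V : set {ptws X -> Y} :=
    [set g | {in s, forall x, mdist (val z x) (g x) < e}].
  have /cval zV : nbhs (val z) V by apply/nbhs_ptwsP; exists s, e.
  by apply: (filterS (P := set_val @^-1` V)) zV => h; exact: sA.
Qed.

Lemma hausdorff_subspace : hausdorff_space (set_type H).
Proof.
move=> f g fg; apply: contrapT => neq_fg.
have [x fgx] : exists x, val f x <> val g x.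
  by apply/existsNP => eq_fg; apply/neq_fg/val_inj/funext.
pose d := mdist (val f x) (val g x).
have d0 : 0 < d by rewrite mdist_gt0; apply/eqP.
have nb (h : set_type H) : nbhs h [set k | mdist (val h x) (val k x) < d / 2].
  apply/nbhs_subspaceP; exists [:: x], (d / 2).
  split; first by rewrite divr_gt0.
  by move=> k; apply; exact: mem_head.
have [h [/= fh gh]] := fg _ _ (nb f) (nb g).
have := metric_triangle (val f x) (val h x) (val g x).
rewrite (metric_sym (val h x)) -/d; lra.
Qed.

Lemma cvg_subspace_eventually_eq (u : nat -> set_type H) (z : set_type H) :
  (forall x, \forall m \near \oo, val (u m) x = val z x) -> u @ \oo --> z.
Proof.
move=> uz A /nbhs_subspaceP[s [e [e0 sA]]].
have us : \forall m \near \oo, {in s, forall x, val (u m) x = val z x}.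
  elim: s {sA} => [|x s IHs]; first by apply: filterE => m x.
  apply: filterS (filterI (uz x) IHs) => m [ux us] y.
  by rewrite inE => /predU1P[->|/us].
apply: filterS us => m us; apply: sA => x xs.
by rewrite us// mdistxx.
Qed.

End PointwiseNbhs.

(** * Countable domains *)

Section CountableDomain.
Context {R : realType} {X : topologicalType} {Y : metricType R}.
Variable e : X -> nat.
Hypothesis inj_e : injective e.

Let finite_lt n : finite_set [set x | (e x < n)%N].
Proof.
apply: (@finite_preimage _ _ `I_n e); last exact: finite_II.
by move=> x y _ _; exact: inj_e.
Qed.

Lemma stable_Baire1_countable (y0 : Y) : Y_Tychonoff X Y ->
  @stable_Baire1 X Y = setT.
Proof.
move=> hX; apply/seteqP; split=> // f _.
have /choice[u uP] : forall n, exists g : X -> Y, continuous g /\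
    forall x, (e x < n)%N -> g x = f x.
  move=> n; have [|g [cg gf _]] := hX _ y0 _ f closed0 (finite_lt n).
    by move=> x _ [].
  by exists g.
exists u; split=> [n|x]; first by have [] := uP n.
apply: sub_finite_set (finite_II (e x).+1) => n /=.
by apply: contra_notP => /negP; rewrite -leqNgt => xn; have [_ ->] := uP n.
Qed.

Let w x : R := (e x).+1%:R^-1.
Let term (f g : X -> Y) x : R := Num.min (mdist (f x) (g x)) (w x).
(* The term 0 keeps the set nonempty when there are no points. *)
Let terms f g : set R := [set 0] `|` range (term f g).
Let D f g : R := sup (terms f g).

Let w_gt0 x : 0 < w x. Proof. by rewrite invr_gt0. Qed.

Let D_le f g c : 0 <= c -> (forall x, term f g x <= c) -> D f g <= c.
Proof.
move=> c0 fgc; apply: ge_sup; first by exists 0; left.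
by move=> _ [->//|[x _ <-]].
Qed.

Let has_ub_terms f g : has_ubound (terms f g).
Proof.
exists 1 => _ [->//|[x _ <-]].
by rewrite ge_min /w invf_le1 ?ler1n ?orbT.
Qed.

Let term_le f g x : term f g x <= D f g.
Proof. by apply: ub_le_sup => //; right; exists x. Qed.

Let D_ge0 f g : 0 <= D f g.
Proof. by apply: ub_le_sup => //; left. Qed.

(** The metric is the supremum of the coordinate distances, the one at [x] being
    cut off at [1 / (e x + 1)]: being [D]-close constrains only finitely many
    coordinates, because all others are cut off below the given bound. *)
Lemma metrizable_countable (H : set {ptws X -> Y}) : metrizable R (set_type H).
Proof.
exists (fun f g => D (val f) (val g)); split=> [f g|f g|f g h|z A].
- split=> [D0|->].
  + apply: val_inj; apply/funext => x; apply: mdist_positivity.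
    have := term_le (val f) (val g) x; rewrite D0 /term ge_min.
    rewrite [w x <= 0]leNgt w_gt0 orbF => fg0.
    by apply/eqP; rewrite eq_le fg0 mdist_ge0.
  + apply/eqP; rewrite eq_le D_ge0 andbT; apply: D_le => // x.
    by rewrite /term mdistxx ge_min lexx.
- rewrite /D /terms (_ : term _ _ = term (val g) (val f))//.
  by apply/funext => x; rewrite /term metric_sym.
- apply: D_le => [|x]; first exact: addr_ge0.
  apply: le_trans (lerD (term_le _ _ x) (term_le _ _ x)).
  apply: min_triangle; [exact: mdist_ge0|exact: mdist_ge0|exact: ltW|].
  exact: metric_triangle.
- rewrite nbhs_subspaceP; split=> [[s [c [c0 sA]]]|[c c0 cA]].
  + have [d [d0 dc dw]] :
        exists d, [/\ 0 < d, d <= c & {in s, forall x, d <= w x}].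
      elim: s {sA} => [|x s [d [d0 dc dw]]]; first by exists c.
      exists (Num.min d (w x)); rewrite lt_min d0 w_gt0 ge_min dc; split=> // y.
      by rewrite inE ge_min => /predU1P[->|/dw->//]; rewrite lexx orbT.
    exists d => // h /= zh; apply: sA => x xs.
    have := le_lt_trans (term_le _ _ x) zh.
    rewrite /term gt_min [w x < d]ltNge dw// orbF => /lt_le_trans; exact.
  + have [n nc] := ex_natSinv_lt c0.
    have /finite_seqP[s sE] := finite_lt n.
    exists s, n.+1%:R^-1; split=> [|h zh]; first by rewrite invr_gt0.
    apply: cA => /=; apply: le_lt_trans nc; apply: D_le => [|x].
      by rewrite invr_ge0.
    rewrite /term ge_min; have [xn|nx] := ltnP (e x) n.
      by rewrite ltW// zh//; have : [set` s] x by rewrite -sE.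
    by rewrite /w lef_pV2 ?posrE// ler_nat ltnS nx orbT.
Qed.

End CountableDomain.

(** * Stable indicators *)

Section StableIndicators.
Context {R : realType} {X : topologicalType} {Y : metricType R}.
Hypothesis hX : Y_Tychonoff X Y.
Variables y0 y1 : Y.

Lemma Y_Tychonoff_separated (a b : X) : a <> b ->
  exists phi : X -> Y, [/\ continuous phi, phi a = y1 & phi b = y0].
Proof.
move=> ab.
have [|||phi [cphi phiF _]] := hX (A := set0) y0 (F := [set a; b])
    (fun x => if x == a then y1 else y0).
- exact: closed0.
- exact: finite_set2.
- by move=> x _ [].
exists phi; split=> //; first by rewrite phiF ?eqxx//; left.
by rewrite phiF; [case: eqP => // ba; case: ab|right].
Qed.

Lemma closed_mdist_geq (phi : X -> Y) (y : Y) (e : R) :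
  continuous phi -> closed [set z | e <= mdist (phi z) y].
Proof.
move=> cphi z clz; rewrite /= leNgt; apply/negP => zy.
pose d := e - mdist (phi z) y.
have d0 : 0 < d by rewrite subr_gt0.
have /clz[w [/= we zw]] : nbhs z [set w | mdist (phi z) (phi w) < d].
  apply: (cphi z [set v | mdist (phi z) v < d]).
  by rewrite -filter_from_mdist_nbhs; exists d.
have := metric_triangle (phi w) (phi z) y; rewrite (metric_sym (phi w) (phi z)).
move: we zw; rewrite /d; lra.
Qed.

(** The approximations [g 0], [g 1], ... are chosen recursively: [g n] takes the
    value [y1] at [x], and the value [y0] at every point [z] where some earlier
    [g m] or [phi m] is at distance at least [eps n] from its value at [x], with
    [eps n] tending to 0.  If one of these functions differs at [z] from its
    value at [x], then [g n z = y0] for all large [n].  Otherwise all the [g n]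
    agree at [z] with their value at [x], which is [y1].  So the sequence
    stabilizes at every point, although nothing was required of the behaviour
    of each [g n] away from [x] and from the region where it is [y0]: the later
    approximations police the earlier ones. *)
Lemma stable_indicator (x : X) (phi : nat -> X -> Y) :
  (forall i, continuous (phi i)) ->
  exists f : X -> Y, [/\ stable_Baire1 f, f x = y1 &
    forall z, f z = y0 \/ f z = y1 /\ forall i, phi i z = phi i x].
Proof.
move=> cphi.
pose far (h : X -> Y) (n : nat) : set X :=
  [set z | n.+1%:R^-1 <= mdist (h z) (h x)].
have closed_far h n : continuous h -> closed (far h n).
  exact: closed_mdist_geq.
have far_x h n : ~ far h n x by rewrite /far /= mdistxx leNgt invr_gt0 ltr0Sn.
have /choice[step stepP] : forall s : seq (X -> Y), exists g : X -> Y,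
    {in s, forall h, continuous h} -> [/\ continuous g, g x = y1 &
      forall h z, h \in s -> far h (size s) z -> g z = y0].
  move=> s.
  have [cs|ncs] := pselect {in s, forall h, continuous h}; last first.
    by exists (fun=> y0).
  pose A := \bigcup_(h in [set` s]) far h (size s).
  have clA : closed A.
    apply: closed_bigcup => [|h /= hs]; first exact: finite_seq.
    by apply: closed_far; exact: cs.
  have [||g [cg gx gA]] := hX y0 (F := [set x]) (fun=> y1) clA.
  - exact: finite_set1.
  - by move=> _ -> [h _]; exact: far_x.
  exists g => _; split=> //; first exact: gx.
  move=> h z hs hz; apply: gA; exists z => //; by exists h.
(* [L n] lists the functions controlled by the [n]-th approximation, which is
   [step (L n)]; the bound [eps n] is [1 / (size (L n) + 1)]. *)
pose L := fix L n : seq (X -> Y) :=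
  if n is m.+1 then [:: step (L m), phi m & L m] else [::].
have cL n : {in L n, forall h, continuous h}.
  elim: n => [//|n IHn] h; rewrite !inE => /or3P[/eqP->|/eqP->|]//.
  - by have [] := stepP _ IHn.
  - exact: IHn.
have subL m n : (m <= n)%N -> {subset L m <= L n}.
  move=> /subnK <-; elim: (n - m)%N => [//|k IHk] h /IHk hL.
  by rewrite addSn !inE hL !orbT.
have sizeL n : (n <= size (L n))%N by elim: n => //= n /leqW.
pose good z := forall n, {in L n, forall h, h z = h x}.
exists (fun z => if `[< good z >] then y1 else y0); split.
- exists (fun n => step (L n)); split=> [n|z].
    by have [] := stepP _ (cL n).
  case: asboolP => [goodz|].
    apply: sub_finite_set (@finite_set0 nat) => n; case.
    rewrite (goodz n.+1); first by have [_ ->] := stepP _ (cL n).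
    exact: mem_head.
  move=> /existsNP[m /existsNP[h /not_implyP[hL hzx]]].
  have [k ke] : exists k, k.+1%:R^-1 < mdist (h z) (h x).
    by apply: ex_natSinv_lt; rewrite mdist_gt0; apply/eqP.
  apply: sub_finite_set (finite_II (maxn m k)) => n /=.
  apply: contra_notP => /negP; rewrite -leqNgt geq_max => /andP[mn kn].
  have [_ _ gn] := stepP _ (cL n); apply: (gn h); first exact: subL hL.
  rewrite /far /=; apply: le_trans (ltW ke).
  by rewrite lef_pV2 ?posrE// ler_nat ltnS (leq_trans kn).
- by rewrite asboolT.
- move=> z; case: asboolP => [goodz|_]; [right|by left].
  by split=> // i; apply: (goodz i.+1); rewrite !inE eqxx orbT.
Qed.

Hypothesis y01 : y0 <> y1.

Lemma separating_maps : exists psi : X -> X -> X -> Y, forall a b,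
  continuous (psi a b) /\ (psi a b a = psi a b b -> a = b).
Proof.
have /choice[psi psiP] : forall p : X * X, exists phi : X -> Y,
    continuous phi /\ (phi p.1 = phi p.2 -> p.1 = p.2).
  move=> [a b] /=; have [->|/eqP ab] := eqVneq a b.
    by exists (fun=> y0); split=> // z; exact: cst_continuous.
  have [phi [cphi phia phib]] := Y_Tychonoff_separated ab.
  by exists phi; split=> //; rewrite phia phib => /esym.
by exists (fun a b => psi (a, b)) => a b; exact: psiP.
Qed.

(** All the indicators are built from one and the same countable family of maps,
    which separates the points [x m].  At a common point of two supports this
    family would take the values that it has at both centres. *)
Lemma disjoint_stable_indicators (x : nat -> X) : injective x ->
  exists f : nat -> X -> Y, forall m, [/\ stable_Baire1 (f m), f m (x m) = y1 &
    forall z, f m z <> y0 -> forall j, j != m -> f j z = y0].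
Proof.
move=> inj_x; have [psi psiP] := separating_maps.
pose phi i := if unpickle i is Some (j, m) then psi (x j) (x m)
              else psi (x 0%N) (x 0%N).
have cphi i : continuous (phi i).
  by rewrite /phi; case: unpickle => [[n k]|]; exact: (psiP _ _).1.
have /choice[f fP] := fun m => stable_indicator (x m) cphi.
exists f => m; have [sf fx fz] := fP m; split=> // z fmz j.
have [_ _ /(_ z)[//|[_ zj]]] := fP j.
case: (fz z) => [//|[_ zm]]; case/eqP; apply: inj_x; apply: (psiP _ _).2.
by have := zj (pickle (j, m)); rewrite zm /phi pickleK.
Qed.

(** * Network conditions that force a countable domain *)

Variable H : set {ptws X -> Y}.
Hypothesis hstH : @stable_Baire1 X Y `<=` H.

Let in_H f (sf : @stable_Baire1 X Y f) : set_type H :=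
  exist _ f (mem_set (hstH sf)).

Let stable_cst : @stable_Baire1 X Y (fun=> y0).
Proof.
exists (fun _ _ => y0); split=> [n|x]; first exact: cst_continuous.
by apply: sub_finite_set (@finite_set0 nat) => n; case.
Qed.

Let h0 : set_type H := in_H stable_cst.

(** The finite sets of coordinates that bound countably many neighbourhoods of
    the constant function [y0] with intersection reduced to it must exhaust [X]:
    a stable indicator of a point outside their union that is equal to [y0] on
    this union would be a second common point. *)
Lemma countable_of_sigma_space :
  sigma_space (set_type H) -> countable [set: X].
Proof.
move=> sH.
have [G [zG Gz]] :=
  sigma_space_point_Gdelta h0 (hausdorff_subspace (H := H)) sH.
have /choice[s sP] : forall n, exists s : seq X, forall h : set_type H,
    {in s, forall x, val h x = y0} -> G n h.
  move=> n; have /nbhs_subspaceP[s [e [e0 sG]]] := zG n.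
  by exists s => h hs; apply: sG => x xs; rewrite hs// mdistxx.
apply: (@sub_countable _ _ _ (\bigcup_n [set` s n])); last first.
  apply: bigcup_countable => // n _.
  by apply: finite_set_countable; exact: finite_seq.
apply: subset_card_le => x _; apply: contrapT => nsx.
have [psi psiP] := separating_maps.
pose phi i := if unpickle i is Some (n, k) then psi x (nth x (s n) k)
              else psi x x.
have cphi i : continuous (phi i).
  by rewrite /phi; case: unpickle => [[n k]|]; exact: (psiP _ _).1.
have [f [sf fx fP]] := stable_indicator x cphi.
suff : in_H sf = h0.
  by move=> /(congr1 val) /= ff; apply: y01; rewrite -fx ff.
apply: Gz => n; apply: sP => b bs /=.
case: (fP b) => [//|[_ /(_ (pickle (n, index b (s n))))]].
rewrite /phi pickleK nth_index// => /esym/(psiP x b).2 xb.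
by case: nsx; exists n => //=; rewrite xb.
Qed.

(** Types of points are encoded as bit sequences, so that there are visibly
    countably many of them, and [E b] is the class of the points at which every
    network member selected by [b] is admissible.  If each point had a type with
    finite class, [X] would be a countable union of finite sets. *)
Lemma countable_of_cs_star :
  countable_cs_star_character (set_type H) -> countable [set: X].
Proof.
move=> csH.
have [N /countable_injP[c inj_c] csN] := csH h0.
pose O x : set (set_type H) := [set h | val h x <> y1].
have nbhsO x : nbhs h0 (O x).
  apply/nbhs_subspaceP; exists [:: x], (mdist y0 y1); split.
    by rewrite mdist_gt0; apply/eqP.
  by move=> h /(_ x (mem_head _ _)) /= + hx; rewrite hx ltxx.
pose E (b : seq bool) : set X :=
  [set x | forall A, N A -> nth false b (c A) -> A `<=` O x].
pose type x m : seq bool :=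
  mkseq (fun i => `[< exists2 A, N A /\ c A = i & A `<=` O x >]) m.
have type_in x m : E (type x m) x.
  move=> A NA; have [cm|mc] := ltnP (c A) m; last first.
    by rewrite nth_default// size_mkseq.
  rewrite nth_mkseq// => /asboolP[B [NB cBA] BO]; suff <- : B = A by [].
  by apply: inj_c; rewrite ?inE.
have [[x infE]|] := pselect (exists x, forall m, infinite_set (E (type x m)));
    last first.
  move=> /forallNP fin.
  apply: (@sub_countable _ _ _ (\bigcup_(b in [set b | finite_set (E b)]) E b)).
    apply: subset_card_le => x _.
    have /existsNP[m /contrapT finE] := fin x.
    by exists (type x m).
  by apply: bigcup_countable => // b; exact: finite_set_countable.
have [p [inj_p Ep]] := infinite_sets_transversal infE.
have [f fP] := disjoint_stable_indicators inj_p.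
have sf m : stable_Baire1 (f m) by have [] := fP m.
have uz : (fun m => in_H (sf m)) @ \oo --> h0.
  apply: cvg_subspace_eventually_eq => z /=.
  have [[m fmz]|] := pselect (exists m, f m z <> y0); last first.
    by move=> /forallNP fz; apply: filterE => m; exact: contrapT.
  exists m.+1 => // j /= mj; have [_ _ /(_ z fmz j) ->//] := fP m.
  by rewrite gtn_eqF.
have [A [NA Az AO infA]] := csN _ _ uz (nbhsO x).
(* Only for [m] beyond the index of [A] does the type at level [m] record that
   [A] is contained in [O x]. *)
have [m [/= Am mc]] : exists m, A (in_H (sf m)) /\ (c A < m)%N.
  apply: contrapT => nm; apply: infA.
  apply: sub_finite_set (finite_II (c A).+1) => m /= Am.
  by rewrite ltnS leqNgt; apply/negP => cm; apply: nm; exists m.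
have [_ fpm _] := fP m.
suff /(_ _ Am) /(_ fpm) : A `<=` O (p m) by [].
apply: (Ep m A NA); rewrite nth_mkseq//.
by apply/asboolP; exists A.
Qed.

End StableIndicators.

(* The type [set_type H] carries the subspace topology inherited from the
   product topology of {ptws X -> Y}. *)
Theorem corollary5p12 (R : realType) (Y : metricType R) (X : topologicalType)
    (hY : exists y0 y1 : Y, y0 <> y1)
    (hX : Y_Tychonoff X Y)
    (H : set {ptws X -> Y})
    (hstH : @stable_Baire1 X Y `<=` H)
    (hHB : H `<=` @Baire_functions X Y) :
  [<-> metrizable R (set_type H) /\ H = [set: {ptws X -> Y}];
       sigma_space (set_type H);
       countable_cs_star_character (set_type H);
       countable [set: X]].
Proof.
have [y0 [y1 y01]] := hY.
have metH : countable [set: X] ->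
    metrizable R (set_type H) /\ H = [set: {ptws X -> Y}].
  move=> /countable_injP[e inj_e].
  have {}inj_e : injective e by move=> x z; apply: inj_e; rewrite inE.
  split; first exact: metrizable_countable inj_e H.
  apply/seteqP; split=> // f _; apply: hstH.
  by rewrite (stable_Baire1_countable inj_e y0 hX).
tfae.
- by move=> [/metrizable_sigma_space].
- (* A sigma-space need not have countable cs*-character in general; the
     implication goes through the countability of [X]. *)
  move=> /(countable_of_sigma_space hX y01 hstH)/metH[+ _].
  exact: metrizable_cs_star.
- by move=> /(countable_of_cs_star hX y01 hstH).
- exact: metH.
Qed.
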